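(* Let $R$ be a maximal subring of a ring $T$. Then either $Soc({}_RR)=Soc({}_RT)$, or there exists a semisimple left $R$-submodule $A$ of $T$ such that $T=R\oplus A$; in the latter case, $(R:T)_r$ is a left primitive ideal of $R$. Likewise, either $Soc(R_R)=Soc(T_R)$, or there exists a semisimple right $R$-submodule $B$ of $T$ such that $T=R\oplus B$; in the latter case, $(R:T)_l$ is a right primitive ideal of $R$.
   Context: All rings are associative and unital (not necessarily commutative), and subrings contain the identity of the big ring. A maximal subring $R$ of $T$ is a proper subring with no subring strictly between $R$ and $T$. $Soc({}_RM)$ and $Soc(M_R)$ denote the socles of a left, resp. right, $R$-module $M$. $(R:T)_l=\{x\in T: Tx\subseteq R\}$ and $(R:T)_r=\{x\in T: xT\subseteq R\}$; both are ideals of $R$. The direct sums are internal direct sums of left (resp. right) $R$-submodules of $T$. *)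

(* Defs.v *)
From HB Require Import structures.
From mathcomp Require Import all_boot all_algebra.
From mathcomp Require Import boolp classical_sets.
Set Implicit Arguments.
Unset Strict Implicit.
Unset Printing Implicit Defensive.

Import GRing.Theory.
Local Open Scope classical_set_scope.
Local Open Scope ring_scope.

(* Right modules over S are left modules over the converse ring S^c; in
   particular the regular right module S_S is (S^c)^o. *)

(* All notions below are stated for Prop-valued sets; R : subringClosed T is
   carried by a boolean predicate, which by boolp.asbool is no restriction. *)

Section Modules.
Variables (S : pzRingType) (M : lmodType S).
Implicit Types (N A B : set M) (F : set (set M)).

Definition submodule N := GRing.submod_closed (mem N).

Definition simple_submodule N :=
  [/\ submodule N, N <> [set 0] &
      forall N', submodule N' -> N' `<=` N -> N' = [set 0] \/ N' = N].

Definition sum_of F : set M :=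
  [set x | exists s : seq M,
     (forall y, y \in s -> exists2 N, F N & N y) /\ x = \sum_(y <- s) y].

Definition Soc : set M := sum_of simple_submodule.

(* A is the sum of its simple submodules. *)
Definition semisimple_submodule A :=
  submodule A /\ A = sum_of [set N | simple_submodule N /\ N `<=` A].

Definition internal_direct_sum A B :=
  (forall x, exists a b, [/\ A a, B b & x = a + b]) /\ A `&` B = [set 0].

Definition simple_module := simple_submodule [set: M].

Definition annihilator : set S := [set r | forall x : M, r *: x = 0].

End Modules.

Arguments Soc {S} M.
Arguments simple_module {S} M.
Arguments annihilator {S} M.

(* T as the left R-module _R T and as the right R-module T_R; R only selects
   the scalar action. *)
Definition lrestr (T : pzRingType) (R : subringClosed T) : Type := T.
Definition rrestr (T : pzRingType) (R : subringClosed T) : Type := T.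

Section Subrings.
Variables (T : pzRingType) (R : subringClosed T).

Definition maximal_subring :=
  [set` R] <> [set: T] /\
  forall S : set T, GRing.subring_closed (mem S) -> [set` R] `<=` S ->
    S = [set` R] \/ S = [set: T].

Record subring := Subring { subring_val : T; _ : subring_val \in R }.

HB.instance Definition _ := [isSub for subring_val].
HB.instance Definition _ := [Choice of subring by <:].
HB.instance Definition _ :=
  GRing.SubChoice_isSubPzRing.Build T (mem R) subring (subringClosedP R).

HB.instance Definition _ := GRing.Zmodule.on (lrestr R).

Definition lrestr_scale (r : subring) (x : lrestr R) : lrestr R :=
  (val r * x : T).

Fact lrestr_scaleA r s x :
  lrestr_scale r (lrestr_scale s x) = lrestr_scale (r * s) x.
Proof. exact: mulrA. Qed.

Fact lrestr_scale1 : left_id 1 lrestr_scale.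
Proof. exact: mul1r. Qed.

Fact lrestr_scaleDr : right_distributive lrestr_scale +%R.
Proof. by move=> r x y; apply: mulrDr. Qed.

Fact lrestr_scaleDl x : {morph lrestr_scale^~ x : r s / r + s}.
Proof. by move=> r s; apply: mulrDl. Qed.

HB.instance Definition _ := GRing.Zmodule_isLmodule.Build subring (lrestr R)
  lrestr_scaleA lrestr_scale1 lrestr_scaleDr lrestr_scaleDl.

HB.instance Definition _ := GRing.Zmodule.on (rrestr R).

Definition rrestr_scale (r : subring^c) (x : rrestr R) : rrestr R :=
  (x * val (r : subring) : T).

Fact rrestr_scaleA r s x :
  rrestr_scale r (rrestr_scale s x) = rrestr_scale (r * s) x.
Proof. by rewrite /rrestr_scale -mulrA. Qed.

Fact rrestr_scale1 : left_id 1 rrestr_scale.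
Proof. by move=> x; apply: mulr1. Qed.

Fact rrestr_scaleDr : right_distributive rrestr_scale +%R.
Proof. by move=> r x y; apply: mulrDl. Qed.

Fact rrestr_scaleDl x : {morph rrestr_scale^~ x : r s / r + s}.
Proof. by move=> r s; apply: mulrDr. Qed.

HB.instance Definition _ := GRing.Zmodule_isLmodule.Build subring^c (rrestr R)
  rrestr_scaleA rrestr_scale1 rrestr_scaleDr rrestr_scaleDl.

(* (R : T)_l and (R : T)_r *)
Definition lconductor : set T := [set x | forall t, t * x \in R].
Definition rconductor : set T := [set x | forall t, x * t \in R].

(* P is a subset of T: the equality below also says that P is contained in R.
   An annihilator is always a two-sided ideal. *)
Definition left_primitive_ideal (P : set T) :=
  exists2 M : lmodType subring,
    simple_module M & P = subring_val @` annihilator M.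

Definition right_primitive_ideal (P : set T) :=
  exists2 M : lmodType subring^c,
    simple_module M & P = subring_val @` annihilator M.

End Subrings.

(* Main.v *)
(** Write [_R T] for [T] as a left [R]-module.  Right multiplications by
    elements of [T] are endomorphisms of [_R T], so for a fully invariant
    submodule [N] of [_R T] the set [R + N] is a subring; by maximality,
    [N] is contained in [R] or [T = R + N].

    Apply this to [N = Soc(_R T)].  In the first case the socles agree.  In the
    second one, a semisimple submodule [A] maximal with respect to
    [A] meeting [R] trivially is a complement of [R] in [T].

    If [T = R + A] is a direct sum with [A] semisimple, take a simple submodule
    [N] of [A], let [I] be its annihilator, and apply the dichotomy to the set
    of elements of [T] killed by [I].  It contains [N], which is not inside
    [R], so [T] is the sum of [R] and this set, whence [I T] is contained in
    [R].  Conversely [r T] inside [R] forces [r N] into the intersection of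
    [R] and [N], which is zero.  So [(R : T)_r = I].

    The right-hand statement is the same fact about [T_R]. *)
Require Import Defs.
From HB Require Import structures.
From mathcomp Require Import all_boot all_algebra.
From mathcomp Require Import boolp classical_sets.
Set Implicit Arguments.
Unset Strict Implicit.
Unset Printing Implicit Defensive.

Import GRing.Theory.
Local Open Scope classical_set_scope.
Local Open Scope ring_scope.

(** * Submodules, sums of simple submodules, and relative complements in the socle *)

Section Submodules.
Variables (S : pzRingType) (V : lmodType S).
Implicit Types (N A B : set V) (F : set (set V)).

Lemma submoduleP N :
  submodule N <-> N 0 /\ forall a u v, N u -> N v -> N (a *: u + v).
Proof.
split=> [[N0 Nlin]|[N0 Nlin]]; split.
- exact: set_mem.
- by move=> a u v Nu Nv; apply: set_mem; apply: Nlin; apply: mem_set.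
- exact: mem_set.
- move=> a u v /set_mem Nu /set_mem Nv; apply: mem_set; exact: Nlin.
Qed.

Lemma submodule0 N : submodule N -> N 0.
Proof. by case/submoduleP. Qed.

Lemma submoduleZ N a u : submodule N -> N u -> N (a *: u).
Proof. by case/submoduleP=> N0 Nlin Nu; rewrite -[_ *: _]addr0; apply: Nlin. Qed.

Lemma submoduleD N u v : submodule N -> N u -> N v -> N (u + v).
Proof. by case/submoduleP=> _ Nlin Nu Nv; rewrite -[u]scale1r; apply: Nlin. Qed.

Lemma submoduleB N u v : submodule N -> N u -> N v -> N (u - v).
Proof.
by move=> hN Nu Nv; rewrite -scaleN1r; apply: submoduleD => //; apply: submoduleZ.
Qed.

Lemma submodule_set0 : submodule [set 0 : V].
Proof.
by apply/submoduleP; split=> // a u v /= -> ->; rewrite scaler0 addr0.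
Qed.

Lemma submoduleI A B : submodule A -> submodule B -> submodule (A `&` B).
Proof.
move=> /submoduleP[A0 Al] /submoduleP[B0 Bl]; apply/submoduleP; split=> //.
by move=> a u v [Au Bu] [Av Bv]; split; [apply: Al|apply: Bl].
Qed.

Definition add_sets A B : set V := [set x | exists a b, [/\ A a, B b & x = a + b]].

Lemma submodule_add A B : submodule A -> submodule B -> submodule (add_sets A B).
Proof.
move=> hA hB; apply/submoduleP; split.
  by exists 0, 0; rewrite addr0; split=> //; apply: submodule0.
move=> a _ _ [u [v [Au Bv ->]]] [u' [v' [Au' Bv' ->]]].
exists (a *: u + u'), (a *: v + v'); split; last by rewrite scalerDr addrACA.
- by case/submoduleP: hA => _; apply.
- by case/submoduleP: hB => _; apply.
Qed.

Lemma sub_add_setsl A B : B 0 -> A `<=` add_sets A B.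
Proof. by move=> B0 x Ax; exists x, 0; rewrite addr0. Qed.

Lemma sub_add_setsr A B : A 0 -> B `<=` add_sets A B.
Proof. by move=> A0 x Bx; exists 0, x; rewrite add0r. Qed.

Lemma sub_sum_of F N : F N -> N `<=` sum_of F.
Proof.
move=> FN x Nx; exists [:: x]; split; last by rewrite big_seq1.
by move=> y; rewrite inE => /eqP ->; exists N.
Qed.

Lemma submodule_sum_of F :
  (forall N, F N -> submodule N) -> submodule (sum_of F).
Proof.
move=> hF; apply/submoduleP; split; first by exists [::]; rewrite big_nil.
move=> a _ _ [s [hs ->]] [t [ht ->]].
exists ([seq a *: y | y <- s] ++ t); split.
  move=> y; rewrite mem_cat => /orP[/mapP[z /hs[N FN Nz] ->]|/ht//].
  by exists N => //; apply: submoduleZ => //; apply: hF.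
by rewrite big_cat big_map scaler_sumr.
Qed.

Lemma sum_of_min F B :
  submodule B -> (forall N, F N -> N `<=` B) -> sum_of F `<=` B.
Proof.
move=> hB hF _ [s [hs ->]]; elim: s hs => [_|y s IHs hs].
  by rewrite big_nil; apply: submodule0.
rewrite big_cons; apply: submoduleD => //.
  by have [|N FN Ny] := hs y; [rewrite mem_head|apply: hF Ny].
by apply: IHs => z zs; apply: hs; rewrite in_cons zs orbT.
Qed.

Lemma simple_submodule_sub N : simple_submodule N -> submodule N.
Proof. by case. Qed.

Lemma simple_capP N A : simple_submodule N -> submodule A ->
  N `&` A `<=` [set 0] \/ N `<=` A.
Proof.
case=> hN _ Nmin hA.
have [||->|NA] := Nmin (N `&` A); first exact: submoduleI.
- by move=> x [].
- by left.
- by right=> x; rewrite -NA => -[].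
Qed.

Lemma submodule_Soc : submodule (Soc V).
Proof. exact: submodule_sum_of simple_submodule_sub. Qed.

Lemma semisimple_has_simple A : semisimple_submodule A -> A <> [set 0] ->
  exists2 N, simple_submodule N & N `<=` A.
Proof.
move=> [hA Asum] A0; apply: contrapT => nN; apply: A0.
rewrite eqEsubset; split; last by move=> x ->; apply: submodule0.
rewrite {1}Asum; apply: sum_of_min; first exact: submodule_set0.
by move=> N [sN NA]; case: nN; exists N.
Qed.

Lemma semisimpleP A : submodule A ->
  A `<=` sum_of [set N | simple_submodule N /\ N `<=` A] ->
  semisimple_submodule A.
Proof.
move=> hA Asub; split=> //; rewrite eqEsubset; split=> //.
by apply: sum_of_min => // N [].
Qed.

(** Zorn's lemma gives [A] maximal among the sums of simple submodules meeting [B] trivially. A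
    simple [N] outside [B + A] meets it in zero, so [A + N] would still qualify, against
    maximality. *)
Lemma semisimple_Soc_complement B : submodule B ->
  exists A, [/\ semisimple_submodule A, A `&` B = [set 0] &
                Soc V `<=` add_sets B A].
Proof.
move=> hB.
pose simples A := [set N | simple_submodule N /\ N `<=` A].
have simplesS A A' : A `<=` A' -> sum_of (simples A) `<=` sum_of (simples A').
  move=> AA'; apply: sum_of_min.
    by apply: submodule_sum_of => N [] /simple_submodule_sub.
  by move=> N [sN NA]; apply: sub_sum_of; split=> // x /NA /AA'.
(* [0 \in A] is not required, so that the empty chain is no exception. *)
pose P A := [/\ forall a u v, A u -> A v -> A (a *: u + v),
  A `<=` sum_of (simples A) & A `&` B `<=` [set 0]].
have [F FP Ftot|A [[Alin Ass AB] Amax]] := @Zorn_bigcup _ P.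
  split.
  - move=> a u v [X FX Xu] [Y FY Yv].
    have [XY|YX] := Ftot _ _ FX FY.
    + by exists Y => //; have [Ylin _ _] := FP _ FY; apply: Ylin => //; apply: XY.
    + by exists X => //; have [Xlin _ _] := FP _ FX; apply: Xlin => //; apply: YX.
  - move=> x [X FX Xx]; have [_ Xss _] := FP _ FX.
    by apply: (simplesS X); [move=> y Xy; exists X|apply: Xss].
  - by move=> x [[X FX Xx] Bx]; have [_ _] := FP _ FX; apply.
(* A linearly closed set without [0] is empty, since [0 = -1 *: x + x]; then [[set 0]] is a strictly
   larger candidate. *)
have A0 : A 0.
  apply: contrapT => nA0.
  have Ae x : ~ A x.
    by move=> Ax; apply: nA0; rewrite -(addNr x) -scaleN1r; apply: Alin.
  apply: (Amax [set 0]).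
    by split=> [x /Ae//|A0]; apply: nA0; apply: A0.
  split; last by move=> x [].
    by case/submoduleP: submodule_set0.
  move=> x ->; apply: submodule0.
  by apply: submodule_sum_of => N [] /simple_submodule_sub.
have hA : submodule A by apply/submoduleP.
exists A; split; first exact: semisimpleP.
  rewrite eqEsubset; split=> // x ->; split=> //; exact: submodule0.
have hBA := submodule_add hB hA.
apply: sum_of_min => // N sN; have hN := simple_submodule_sub sN.
have [NBA|//] := simple_capP sN hBA.
have PAN : P (add_sets A N).
  split.
  - by case/submoduleP: (submodule_add hA hN).
  - have hss : submodule (sum_of (simples (add_sets A N))).
      by apply: submodule_sum_of => N' [] /simple_submodule_sub.
    move=> _ [a [n [Aa Nn ->]]]; apply: submoduleD => //.
      apply: (simplesS A); last exact: Ass.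
      by apply: sub_add_setsl; apply: submodule0.
    apply: (@sub_sum_of _ N) => //; split=> //.
    by apply: sub_add_setsr; apply: submodule0.
  - move=> _ [[a [n [Aa Nn ->]]] Ban].
    (* With [a + n] in [B], the element [n = (a + n) - a] lies both in [N] and in [B + A]. *)
    have n0 : n = 0.
      apply: NBA; split=> //; exists (a + n), (- a).
      by split=> //; [rewrite -sub0r; apply: submoduleB|rewrite addrAC subrr add0r].
    by rewrite n0 addr0 in Ban *; apply: AB.
have AN : A `<=` add_sets A N by apply: sub_add_setsl; apply: submodule0.
have NA : N `<=` A.
  apply: contrapT => nNA; apply: (Amax (add_sets A N)) => //; split=> // ANA.
  by apply: nNA => x Nx; apply: ANA; apply: sub_add_setsr.
by move=> x /NA Ax; apply: sub_add_setsr => //; apply: submodule0.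
Qed.

End Submodules.

(** * Simple submodules and socles under linear maps *)

Section LinearMaps.
Variables (S : pzRingType) (U V : lmodType S) (f : {linear U -> V}).

Lemma submodule_image (N : set U) : submodule N -> submodule (f @` N).
Proof.
move=> /submoduleP[N0 Nlin]; apply/submoduleP; split.
  by exists 0 => //; rewrite linear0.
move=> a _ _ [u Nu <-] [v Nv <-].
by exists (a *: u + v); [apply: Nlin|rewrite linearP].
Qed.

Lemma submodule_preimage (N : set V) : submodule N -> submodule (f @^-1` N).
Proof.
move=> /submoduleP[N0 Nlin]; apply/submoduleP; split; first by rewrite /= linear0.
by move=> a u v Nu Nv; rewrite /= linearP; apply: Nlin.
Qed.

Lemma simple_image (N : set U) : simple_submodule N ->
  f @` N = [set 0] \/ simple_submodule (f @` N).
Proof.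
move=> sN; have hN := simple_submodule_sub sN.
have [|fN0] := pselect (f @` N = [set 0]); first by left.
right; split=> // [|N' hN' N'f]; first exact: submodule_image.
have [Nf0|NN'] := simple_capP sN (submodule_preimage hN').
- left; rewrite eqEsubset; split; last by move=> x ->; apply: submodule0.
  move=> y N'y; have [x Nx fx] := N'f y N'y.
  by rewrite -fx in N'y *; rewrite (Nf0 x) //= linear0.
- right; rewrite eqEsubset; split=> // _ [x Nx <-]; exact: NN'.
Qed.

(** For [U = V] this is the full invariance of the socle. *)
Lemma Soc_linear x : Soc U x -> Soc V (f x).
Proof.
apply: (@sum_of_min _ _ _ (f @^-1` Soc V)).
  exact/submodule_preimage/submodule_Soc.
move=> N sN y Ny /=; have [fN0|sfN] := simple_image sN.
  have: [set 0] (f y) by rewrite -fN0; exists y.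
  by move=> ->; apply: submodule0; apply: submodule_Soc.
by apply: (sub_sum_of sfN); exists y.
Qed.

Lemma simple_of_image (N : set U) : injective f ->
  simple_submodule (f @` N) -> simple_submodule N.
Proof.
move=> finj [hfN fN0 fNmin].
have im_inj : injective (fun A : set U => f @` A).
  have sub (A B : set U) : f @` A = f @` B -> A `<=` B.
    move=> AB x Ax; have : (f @` B) (f x) by rewrite -AB; exists x.
    by case=> y By /finj <-.
  by move=> A B AB; rewrite eqEsubset; split; apply: sub.
have im0 : f @` [set 0] = [set 0].
  rewrite eqEsubset; split; first by move=> _ [x -> <-]; rewrite linear0.
  by move=> x ->; exists 0 => //; rewrite linear0.
split.
- suff -> : N = f @^-1` (f @` N) by apply: submodule_preimage.
  by rewrite eqEsubset; split=> x; [exists x|case=> y Ny /finj <-].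
- by move=> N0; apply: fN0; rewrite N0.
- move=> N' hN' N'N; have [||N'0|N'E] := fNmin (f @` N').
  + exact: submodule_image.
  + by move=> _ [x /N'N Nx <-]; exists x.
  + by left; apply: im_inj; rewrite /= im0.
  + by right; apply: im_inj.
Qed.

(** A simple submodule of [V] lies in [range f], so it is the image of its preimage, which is simple
    by injectivity. *)
Lemma Soc_image : injective f -> Soc V `<=` range f -> f @` Soc U = Soc V.
Proof.
move=> finj SocR; rewrite eqEsubset; split.
  by move=> _ [x /Soc_linear Sx <-].
apply: sum_of_min => [|N sN y Ny]; first exact/submodule_image/submodule_Soc.
have NE : f @` (f @^-1` N) = N.
  rewrite eqEsubset; split=> [_ [x Nx <-]//|z Nz].
  by have [x _ fx] := SocR z (sub_sum_of sN Nz); exists x => //=; rewrite fx.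
rewrite -NE in sN Ny; case: Ny => x Nx <-; exists x => //.
by apply: sub_sum_of Nx; apply: simple_of_image sN.
Qed.

End LinearMaps.

(** * A submodule as a module in its own right *)

Section SubmoduleType.
Variables (S : pzRingType) (V : lmodType S) (N : set V) (hN : submodule N).

(** The proof of [submodule N] is a phantom argument: it lets the module structure be inferred from
    the type alone. *)
Definition submodule_type of submodule N := {x : V | x \in N}.
Local Notation sN := (submodule_type hN).

HB.instance Definition _ := SubChoice.on sN.
HB.instance Definition _ := GRing.SubChoice_isSubLmodule.Build S V
  (fun x => x \in N) sN (GRing.submod_closed_semi hN).

Lemma simple_submodule_type : simple_submodule N -> simple_module sN.
Proof.
move=> simN; apply: (@simple_of_image _ _ _ (val : {linear sN -> V}) setT val_inj).
suff -> : (val : sN -> V) @` setT = N by [].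
rewrite eqEsubset; split=> [_ [x _ <-]|x Nx]; first exact: set_mem (valP x).
by exists (exist _ x (mem_set Nx)).
Qed.

Lemma annihilator_submodule_type r :
  annihilator sN r <-> forall x, N x -> r *: x = 0.
Proof.
split=> [rN x Nx|rN x]; last first.
  by apply: val_inj; rewrite linearZ linear0; apply/rN/set_mem/(valP x).
have := congr1 (val : sN -> V) (rN (exist _ x (mem_set Nx))).
by rewrite linearZ linear0.
Qed.

End SubmoduleType.

(** * The side-independent argument, for an embedding [j] of the regular module *)

Section FullyInvariantDichotomy.
Variables (S : pzRingType) (V : lmodType S) (j : {linear S^o -> V}).
Hypothesis j_inj : injective j.
Hypothesis j_proper : range j <> setT.
Hypothesis dichotomy : forall N : set V, submodule N ->
  (forall f : {linear V -> V}, forall x, N x -> N (f x)) ->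
  N `<=` range j \/ add_sets (range j) N = setT.

Let hR : submodule (range j).
Proof.
by apply: submodule_image; apply/submoduleP.
Qed.

Lemma Soc_eq_or_complement :
  j @` Soc S^o = Soc V \/
  exists A : set V, semisimple_submodule A /\ internal_direct_sum (range j) A.
Proof.
have [SR|RS] := dichotomy (@submodule_Soc _ V) (fun f => @Soc_linear _ _ _ f).
  by left; apply: Soc_image.
right; have [A [ssA AR SRA]] := semisimple_Soc_complement hR.
have hA : submodule A by case: ssA.
exists A; split=> //; split; last by rewrite setIC.
move=> x; have : add_sets (range j) (Soc V) x by rewrite RS.
case=> r [s [Rr /SRA[r' [a [Rr' Aa ->]]] ->]].
by exists (r + r'), a; split=> //; [apply: submoduleD|rewrite addrA].
Qed.

Lemma conductor_annihilates_simple A : semisimple_submodule A ->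
  internal_direct_sum (range j) A ->
  exists2 M : lmodType S, simple_module M &
    annihilator M = [set r | forall v : V, range j (r *: v)].
Proof.
move=> ssA [RA RA0].
have [hA _] := ssA.
have [|N sN NA] := semisimple_has_simple ssA.
  move=> A0; apply: j_proper; rewrite eqEsubset; split=> // x _.
  by have [r [a [Rr Aa ->]]] := RA x; rewrite A0 in Aa; rewrite Aa addr0.
have hN := simple_submodule_sub sN.
exists (submodule_type hN : lmodType S); first exact: simple_submodule_type.
have RN x : range j x -> N x -> x = 0.
  by move=> Rx /NA Ax; have : [set 0] x by rewrite -RA0.
(* [N] itself need not be fully invariant, but the set killed by its annihilator is, because linear
   maps commute with scalars. *)
pose killed := [set v : V | forall r, (forall x, N x -> r *: x = 0) -> r *: v = 0].
have hkilled : submodule killed.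
  apply/submoduleP; split=> [r _|a u v ku kv r rN]; first by rewrite scaler0.
  (* Closure under scaling by [a]: if [r] kills [N], so does [r * a], as [N] is stable under [a]. *)
  rewrite scalerDr scalerA (kv r rN) addr0; apply: (ku (r * a)) => x Nx.
  by rewrite -scalerA; apply: rN; apply: submoduleZ.
have killed_inv (f : {linear V -> V}) x : killed x -> killed (f x).
  by move=> kx r rN; rewrite -linearZ kx // linear0.
have RK : add_sets (range j) killed = setT.
  have [KR|//] := dichotomy hkilled killed_inv.
  (* Otherwise [N], contained in [killed], would lie in [range j] and hence be zero. *)
  case: sN => _ N0 _; case: N0; rewrite eqEsubset; split.
    by move=> x Nx; apply: RN => //; apply: KR => r; apply.
  by move=> x ->; apply: submodule0.
rewrite eqEsubset; split=> r.
- move/annihilator_submodule_type=> rN v.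
  have : add_sets (range j) killed v by rewrite RK.
  case=> x [k [Rx kk ->]].
  by rewrite scalerDr kk // addr0; apply: submoduleZ.
- move=> rR; apply/annihilator_submodule_type => x Nx.
  by apply: RN => //; apply: submoduleZ.
Qed.

End FullyInvariantDichotomy.

(** * Maximal subrings: both sides of the dichotomy and the conductors *)

Section Restriction.
Variables (T : pzRingType) (R : subringClosed T).

Definition lincl (r : (subring R)^o) : lrestr R := val (r : subring R).
Definition rincl (r : ((subring R)^c)^o) : rrestr R := val (r : subring R).
Definition right_mulT (t : T) (x : lrestr R) : lrestr R := (x : T) * t.
Definition left_mulT (t : T) (x : rrestr R) : rrestr R := t * (x : T).

Fact lincl_linear : linear lincl.
Proof. by []. Qed.
HB.instance Definition _ :=
  GRing.isLinear.Build _ _ _ _ lincl lincl_linear.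

Fact rincl_linear : linear rincl.
Proof. by []. Qed.
HB.instance Definition _ :=
  GRing.isLinear.Build _ _ _ _ rincl rincl_linear.

Fact right_mulT_linear t : linear (right_mulT t).
Proof. by move=> a x y; rewrite /right_mulT mulrDl -mulrA. Qed.
HB.instance Definition _ t :=
  GRing.isLinear.Build _ _ _ _ (right_mulT t) (right_mulT_linear t).

Fact left_mulT_linear t : linear (left_mulT t).
Proof. by move=> a x y; rewrite /left_mulT mulrDr mulrA. Qed.
HB.instance Definition _ t :=
  GRing.isLinear.Build _ _ _ _ (left_mulT t) (left_mulT_linear t).

Lemma range_subring_val : range (@subring_val T R) = [set` R].
Proof.
rewrite eqEsubset; split=> [_ [r _ <-]|x Rx]; first exact: (valP r).
by exists (Subring Rx).
Qed.

Hypothesis maxR : maximal_subring R.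

Lemma range_subring_val_proper : range (@subring_val T R) <> setT.
Proof. by rewrite range_subring_val; case: maxR. Qed.

(** The hypotheses make [R + N] a subring containing [R], so maximality leaves only [R] and [T].
    They are symmetric in left and right, to serve both module structures. *)
Lemma maximal_subring_add (N : set T) : N 0 ->
  (forall x y, N x -> N y -> N (x - y)) ->
  (forall r x, r \in R -> N x -> N (r * x) /\ N (x * r)) ->
  (forall x y, N x -> N y -> N (x * y)) ->
  N `<=` [set` R] \/ forall x, exists r n, [/\ r \in R, N n & x = r + n].
Proof.
move=> N0 NB NR NM.
have ND x y : N x -> N y -> N (x + y).
  by move=> Nx Ny; rewrite -[y]opprK -[- y]sub0r; apply/NB/NB.
pose Q := [set x | exists r n, [/\ r \in R, N n & x = r + n]].
have [||QR|QT] := maxR.2 Q.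
- split.
  + by apply: mem_set; exists 1, 0; rewrite rpred1 addr0.
  + move=> _ _ /set_mem[r [n [Rr Nn ->]]] /set_mem[r' [n' [Rr' Nn' ->]]].
    apply: mem_set; exists (r - r'), (n - n'); rewrite rpredB //.
    by split=> //; [apply: NB|rewrite opprD addrACA].
  + move=> _ _ /set_mem[r [n [Rr Nn ->]]] /set_mem[r' [n' [Rr' Nn' ->]]].
    apply: mem_set; exists (r * r'), (r * n' + (n * r' + n * n')).
    split; [exact: rpredM| |by rewrite mulrDl !mulrDr -addrA].
    have [Nrn' _] := NR _ _ Rr Nn'; have [_ Nnr'] := NR _ _ Rr' Nn.
    by apply: (ND) => //; apply: ND => //; apply: NM.
- by move=> x Rx; exists x, 0; rewrite addr0.
- by left; rewrite -QR => x Nx; exists 0, x; rewrite rpred0 add0r.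
- by right=> x; have : Q x by rewrite QT.
Qed.

(** Invariance is used only for right multiplications: it makes [N] a right ideal of [T], hence
    closed under products and under [R] on the right. *)
Lemma lrestr_dichotomy (N : set (lrestr R)) : submodule N ->
  (forall f : {linear lrestr R -> lrestr R}, forall x, N x -> N (f x)) ->
  N `<=` range lincl \/ add_sets (range lincl) N = setT.
Proof.
move=> hN Ninv; have NT t x : N x -> N (x * t : T) := Ninv (right_mulT t) x.
have [||r x Rr Nx|x y Nx _||RN] := @maximal_subring_add N.
- exact: submodule0 hN.
- by move=> x y; apply: submoduleB hN.
- by split; [apply: (submoduleZ (Subring Rr) hN)|apply: NT].
- exact: NT.
- by move=> NR; left; rewrite -range_subring_val in NR.
- right; rewrite eqEsubset; split=> // x _.
  have [r [n [Rr Nn ->]]] := RN x; exists r, n; split=> //.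
  by exists (Subring Rr).
Qed.

Lemma rrestr_dichotomy (N : set (rrestr R)) : submodule N ->
  (forall f : {linear rrestr R -> rrestr R}, forall x, N x -> N (f x)) ->
  N `<=` range rincl \/ add_sets (range rincl) N = setT.
Proof.
move=> hN Ninv; have NT t x : N x -> N (t * x : T) := Ninv (left_mulT t) x.
have [||r x Rr Nx|x y _ Ny||RN] := @maximal_subring_add N.
- exact: submodule0 hN.
- by move=> x y; apply: submoduleB hN.
- by split; [apply: NT|apply: (submoduleZ (Subring Rr : (subring R)^c) hN)].
- exact: NT.
- by move=> NR; left; rewrite -range_subring_val in NR.
- right; rewrite eqEsubset; split=> // x _.
  have [r [n [Rr Nn ->]]] := RN x; exists r, n; split=> //.
  by exists (Subring Rr).
Qed.

Lemma left_primitive_rconductor (A : set (lrestr R)) :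
  semisimple_submodule A -> internal_direct_sum (range lincl) A ->
  left_primitive_ideal R (rconductor R).
Proof.
move=> ssA dsA.
have [M sM annM] := @conductor_annihilates_simple _ _ lincl
  range_subring_val_proper lrestr_dichotomy _ ssA dsA.
exists M => //; rewrite annM eqEsubset; split=> [x xT|_ [r rT <-] t].
  (* The conductor lies in [R] because [x = x * 1]; thus [x] is a scalar of the module. *)
  have Rx : x \in R by rewrite -[x]mulr1.
  by exists (Subring Rx) => // v; exists (Subring (xT v)).
by have [s _ sE] := rT t; rewrite -[_ * t]sE; apply: (valP s).
Qed.

Lemma right_primitive_lconductor (B : set (rrestr R)) :
  semisimple_submodule B -> internal_direct_sum (range rincl) B ->
  right_primitive_ideal R (lconductor R).
Proof.
move=> ssB dsB.
have [M sM annM] := @conductor_annihilates_simple _ _ rincl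
  range_subring_val_proper rrestr_dichotomy _ ssB dsB.
exists M => //; rewrite annM eqEsubset; split=> [x xT|_ [r rT <-] t].
  have Rx : x \in R by rewrite -[x]mul1r.
  by exists (Subring Rx) => // v; exists (Subring (xT v)).
by have [s _ sE] := rT t; rewrite -[t * _]sE; apply: (valP s).
Qed.

End Restriction.

Theorem proposition3p3 (T : pzRingType) (R : subringClosed T)
    (maxR : maximal_subring R) :
  (((@subring_val T R) @` Soc (subring R)^o = Soc (lrestr R)
    \/ exists A : set (lrestr R),
         semisimple_submodule A /\
         internal_direct_sum ([set` R] : set (lrestr R)) A)
   /\ (forall A : set (lrestr R),
         semisimple_submodule A ->
         internal_direct_sum ([set` R] : set (lrestr R)) A ->
         left_primitive_ideal R (rconductor R)))
  /\
  (((@subring_val T R) @` Soc ((subring R)^c)^o = Soc (rrestr R)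
    \/ exists B : set (rrestr R),
         semisimple_submodule B /\
         internal_direct_sum ([set` R] : set (rrestr R)) B)
   /\ (forall B : set (rrestr R),
         semisimple_submodule B ->
         internal_direct_sum ([set` R] : set (rrestr R)) B ->
         right_primitive_ideal R (lconductor R))).
Proof.
(* Seen as the range of the inclusion, [R] fits the abstract lemmas with [j] equal to [lincl] or
   [rincl]. *)
rewrite -(range_subring_val R); split; split.
- exact: (@Soc_eq_or_complement _ _ (@lincl T R) val_inj (lrestr_dichotomy maxR)).
- exact: (left_primitive_rconductor maxR).
- exact: (@Soc_eq_or_complement _ _ (@rincl T R) val_inj (rrestr_dichotomy maxR)).
- exact: (right_primitive_lconductor maxR).
Qed.
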